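(* Let $R$ be a finite commutative Frobenius ring, $n$ a positive integer with $nR=0$, $\chi$ a fixed generating character of $R$, and $U$ a subgroup of $R^\times$ with $-1\in U$. Let $\mathcal{K}=\{K_1,\dots,K_m\}$ be the set of orbits of $R$ under multiplication by $U$, with representatives $r_i\in K_i$. (1) Put $X_i=\{\chi_x: x\in K_i\}$ and $\mathcal{X}=\{X_1,\dots,X_m\}$. Then $(\mathcal{K},\mathcal{X})$ is a supercharacter theory for $(R,+)$, with $\mathcal{K}$ symmetric. (2) Let $\Gamma(R,S)$ be a $U$-unitary Cayley graph. Then every eigenvalue of $\Gamma(R,S)$ is a linear combination of generalized Ramanujan sums; explicitly, it is of the form $$\sum_{\ell:\,K_\ell\subset S}\frac{|U_{r_\ell}|}{|U_{r_\ell r_i}|}\;c\bigl(R/\mathrm{Ann}_R(r_\ell r_i),\,U_{r_\ell r_i},\,\chi_{r_\ell r_i}\bigr)$$ for some $1\le i\le m$. (3) Let $T$ be a symmetric subset of $R$ (that is, $T=-T$ and $0\notin T$). Let $K$ be a subfield of $\mathbb{Q}(\zeta_n)$, let $H_1\le \mathrm{Gal}(\mathbb{Q}(\zeta_n)/\mathbb{Q})=(\mathbb{Z}/n)^\times$ be the subgroup corresponding to $K$ under the Galois correspondence, i.e. $K=\mathbb{Q}(\zeta_n)^{H_1}$, and let $U_1$ be the image of $H_1$ under the canonical map $(\mathbb{Z}/n)^\times\to R^\times$. Then $\Gamma(R,T)$ is $K$-rational if and only if it is $U_1$-unitary. (4) Suppose that $U=(R^\times)^p=\{x^p:x\in R^\times\}$,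 where $p$ is either $1$ or a prime number with $\gcd(p,n)=1$. Suppose further that $\Gamma(R,(R^\times)^p)$ is connected and anti-connected. Then $\Gamma(R,(R^\times)^p)$ is prime if and only if $0$ is not an eigenvalue of $\Gamma(R,(R^\times)^p)$.
   Context: Frobenius rings: a finite commutative ring $R$ with $nR=0$ is Frobenius if there is a $\mathbb{Z}/n$-linear map $\psi:R\to\mathbb{Z}/n$ whose kernel contains no non-zero ideal of $R$. With $\zeta_n=e^{2\pi i/n}$, the corresponding generating character is $\chi(a)=\zeta_n^{\psi(a)}$; for $r\in R$ put $\chi_r(a)=\chi(ra)$. Every additive character of $R$ is of the form $\chi_r$ for a unique $r\in R$. Supercharacter theory for a finite abelian group $G$: a pair $(\mathcal{K},\mathcal{X})$, where $\mathcal{K}=\{K_1,\dots,K_m\}$ is a partition of $G$ and $\mathcal{X}=\{X_1,\dots,X_m\}$ is a partition of $\widehat{G}=\mathrm{Hom}(G,\mathbb{C}^\times)$ of the same size, such that: $\{0\}\in\mathcal{K}$; each $\sigma_i=\sum_{\chi\in X_i}\chi$ is constant on each $K_j$; and for all $i,j$ the sum $\sum_{k\in K_j}\chi(k)$ does not depend on the choice of $\chi\in X_i$. $\mathcal{K}$ is symmetric if $K_i=-K_i$ for all $i$. Cayley graphs: for $S\subseteq R$ with $S=-S$ and $0\notin S$, $\Gamma(R,S)$ is the graph with vertex set $R$ in which $u,v$ are adjacent iff $u-v\in S$. Eigenvalues are those of the adjacency matrix. For a subgroup $V\le R^\times$ (in (3), $U_1$ need not contain $-1$), $\Gamma(R,S)$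 is called $V$-unitary if $VS=S$. A graph is $K$-rational if all its eigenvalues lie in $K$. Generalized Ramanujan sums: for a finite commutative ring $A$, a subgroup $V\le A^\times$ and an additive character $\varphi$ of $A$, $c(A,V,\varphi)=\sum_{v\in V}\varphi(v)$. For $x\in R$, $\mathrm{Ann}_R(x)=\{y\in R: yx=0\}$, and $U_x$ is the image of $U$ under $R^\times\to(R/\mathrm{Ann}_R(x))^\times$. The character $\chi_x$ is trivial on $\mathrm{Ann}_R(x)$ and is regarded as a character of $R/\mathrm{Ann}_R(x)$. A graph is anti-connected if its complement is connected. A set $X$ of vertices is homogeneous if every vertex outside $X$ is adjacent to all or to none of the vertices of $X$. A graph with vertex set $V$ is prime if it has no homogeneous set $X$ with $2\le|X|<|V|$. *)

(* Defs.v *)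
From HB Require Import structures.
From mathcomp Require Import all_boot all_order all_fingroup all_algebra.
From mathcomp Require Import all_solvable all_field finmap.

Set Implicit Arguments.
Unset Strict Implicit.
Unset Printing Implicit Defensive.

Import GRing.Theory.
Local Open Scope ring_scope.
Local Open Scope quotient_scope.

(* Complex numbers are the elements of an arbitrary C : numClosedFieldType
   (for instance algC, or R[i] over a real closed field R). *)

Section Frobenius.
Variables (n : nat) (R : finComUnitRingType).

(* The library's idealr_closed only describes proper ideals; R itself is an
   ideal here. *)
Definition ideal (I : {set R}) : Prop :=
  0 \in I /\ forall a, {in I &, forall u v, a * u + v \in I}.

(* The scalar k of Z/n acts on r : R by r *+ k, which is meaningful when
   nR = 0.  As R is nonzero, nR = 0 and 0 < n force 1 < n, so that 'Z_n is
   indeed Z/n. *)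
Definition Zn_linear (psi : R -> 'Z_n) : Prop :=
  forall (k : 'Z_n) (a b : R), psi (a *+ k + b) = k * psi a + psi b.

Definition generating_functional (psi : R -> 'Z_n) : Prop :=
  Zn_linear psi /\
  forall I : {set R}, ideal I -> {in I, forall a, psi a = 0} -> I = [set 0].

Definition frobenius : Prop :=
  (forall r : R, r *+ n = 0) /\ exists psi, generating_functional psi.

Definition generating_character (C : numClosedFieldType) (zeta : C)
    (chi : {ffun R -> C}) : Prop :=
  exists2 psi, generating_functional psi & forall a, chi a = zeta ^+ psi a.

End Frobenius.

Definition mulchar (R : finComUnitRingType) (C : numClosedFieldType)
    (chi : {ffun R -> C}) (r : R) : {ffun R -> C} :=
  [ffun a => chi (r * a)].

Section Supercharacter.
Variables (G : finZmodType) (C : numClosedFieldType).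

Definition add_char (f : {ffun G -> C}) : Prop :=
  (forall a, f a != 0) /\ (forall a b, f (a + b) = f a * f b).

Definition indexed_partition (m : nat) (K : 'I_m -> {set G}) : Prop :=
  injective K /\ partition [set K i | i : 'I_m] [set: G].

Definition char_partition (m : nat) (X : 'I_m -> {fset {ffun G -> C}}) : Prop :=
  [/\ forall i, X i != fset0,
      forall i j, i != j -> [disjoint X i & X j]%fset
    & forall f, add_char f <-> exists i, f \in X i].

Definition supercharacter_theory (m : nat) (K : 'I_m -> {set G})
    (X : 'I_m -> {fset {ffun G -> C}}) : Prop :=
  [/\ indexed_partition K /\ char_partition X,
      exists i, K i = [set 0],
      forall i j, {in K j &, forall a b,
        \sum_(f <- X i) f a = \sum_(f <- X i) f b}
    & forall i j, {in X i &, forall f g : {ffun G -> C},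
        \sum_(a in K j) f a = \sum_(a in K j) g a}].

Definition symmetric_family (m : nat) (K : 'I_m -> {set G}) : Prop :=
  forall i, [set - a | a in K i] = K i.

End Supercharacter.

Section Graphs.
Variable T : finType.
Implicit Types e : rel T.

Definition adjmx (C : numClosedFieldType) e : 'M[C]_#|T| :=
  \matrix_(i, j) (e (enum_val i) (enum_val j))%:R.

Definition compl_graph e : rel T := fun x y => (x != y) && ~~ e x y.

Definition connected e : Prop := forall x y, connect e x y.

Definition anti_connected e : Prop := connected (compl_graph e).

Definition homogeneous e (X : {set T}) : Prop :=
  forall v, v \notin X ->
    {in X, forall x, e v x} \/ {in X, forall x, ~~ e v x}.

Definition prime_graph e : Prop :=
  ~ exists2 X : {set T}, homogeneous e X & (2 <= #|X| < #|T|)%N.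

End Graphs.

Section Cayley.
Variable R : finComUnitRingType.

Definition symmetric_subset (S : {set R}) : Prop :=
  [set - s | s in S] = S /\ 0 \notin S.

Definition cayley (S : {set R}) : rel R := fun u v => u - v \in S.

Definition unitary (V : {set {unit R}}) (S : {set R}) : Prop :=
  [set FinRing.uval v * s | v in V, s in S] = S.

Definition unit_powers (p : nat) : {set {unit R}} :=
  [set (x ^+ p)%g | x : {unit R}].

End Cayley.

(* The library makes {quot I} a ring for proper ideals I only, but
   R / Ann_R(x) is the zero ring when x = 0; hence the possibly-zero (Pz)
   ring structure below on the library's additive quotient. *)
Section AnnQuotient.
Variables (R : finComUnitRingType) (x : R).

Definition ann : {pred R} := [pred y | y * x == 0].

Fact ann_zmod_closed : zmod_closed ann.
Proof.
split=> [|a b]; rewrite !inE ?mul0r // => /eqP a0 /eqP b0.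
by rewrite mulrBl a0 b0 subrr.
Qed.

HB.instance Definition _ := GRing.isZmodClosed.Build R ann ann_zmod_closed.

Definition ann_quot : Type := Quotient.quot ann.

HB.instance Definition _ := GRing.Zmodule.on ann_quot.
HB.instance Definition _ := Quotient.on ann_quot.

(* fingroup's repr hides that of generic_quotient. *)
Local Notation quot_repr := (@generic_quotient.repr R ann_quot).

Fact ann_reprK : cancel quot_repr (\pi_ann_quot).
Proof. exact: reprK. Qed.

HB.instance Definition _ : isCountable ann_quot := CanIsCountable ann_reprK.
HB.instance Definition _ : isFinite ann_quot := CanIsFinite ann_reprK.

Definition ann_quot_one : ann_quot := \pi_ann_quot 1.
Definition ann_quot_mul (p q : ann_quot) : ann_quot :=
  \pi_ann_quot (quot_repr p * quot_repr q).

Lemma eq_ann_quot (a b : R) :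
  (\pi_ann_quot a == \pi_ann_quot b) = ((a - b) * x == 0).
Proof. by rewrite -(Quotient.idealrBE ann) inE. Qed.

Lemma ann_repr_pi (a : R) : quot_repr (\pi_ann_quot a) * x = a * x.
Proof.
by apply/eqP; rewrite -subr_eq0 -mulrBl -eq_ann_quot ann_reprK.
Qed.

Lemma pi_ann_quotM (a b : R) :
  \pi_ann_quot (a * b) = ann_quot_mul (\pi_ann_quot a) (\pi_ann_quot b).
Proof.
apply/eqP; rewrite eq_ann_quot mulrBl subr_eq0; apply/eqP.
by rewrite -[RHS]mulrA ann_repr_pi mulrCA ann_repr_pi mulrCA mulrA.
Qed.

Lemma pi_ann_quotD (a b : R) :
  \pi_ann_quot (a + b) = \pi_ann_quot a + \pi_ann_quot b.
Proof. exact: (Quotient.pi_add ann). Qed.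

Fact ann_quot_mulA : associative ann_quot_mul.
Proof.
move=> p q s; rewrite -[p]ann_reprK -[q]ann_reprK -[s]ann_reprK.
by rewrite -!pi_ann_quotM mulrA.
Qed.

Fact ann_quot_mulC : commutative ann_quot_mul.
Proof. by move=> p q; rewrite /ann_quot_mul mulrC. Qed.

Fact ann_quot_mul1 : left_id ann_quot_one ann_quot_mul.
Proof. by move=> p; rewrite -[p]ann_reprK -pi_ann_quotM mul1r. Qed.

Fact ann_quot_mulDl : left_distributive ann_quot_mul +%R.
Proof.
move=> p q s; rewrite -[p]ann_reprK -[q]ann_reprK -[s]ann_reprK.
by rewrite -pi_ann_quotD -!pi_ann_quotM mulrDl pi_ann_quotD.
Qed.

HB.instance Definition _ := GRing.Zmodule_isComPzRing.Build ann_quot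
  ann_quot_mulA ann_quot_mulC ann_quot_mul1 ann_quot_mulDl.

Definition unit_image (U : {set {unit R}}) : {set ann_quot} :=
  [set \pi_ann_quot (FinRing.uval u) | u in U].

Definition quot_char (C : numClosedFieldType) (chi : {ffun R -> C}) :
    ann_quot -> C :=
  fun q => mulchar chi x (quot_repr q).

Lemma quot_charE (C : numClosedFieldType) (chi : {ffun R -> C}) (a : R) :
  quot_char chi (\pi_ann_quot a) = mulchar chi x a.
Proof. by rewrite /quot_char !ffunE mulrC ann_repr_pi mulrC. Qed.

End AnnQuotient.

(* V is meant to be a subgroup of the unit group of A. *)
Definition ramanujan (C : numClosedFieldType) (A : finComPzRingType)
    (V : {set A}) (phi : A -> C) : C :=
  \sum_(v in V) phi v.

Definition eigen_sum (R : finComUnitRingType) (C : numClosedFieldType)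
    (chi : {ffun R -> C}) (U : {set {unit R}}) (S : {set R})
    (m : nat) (K : 'I_m -> {set R}) (r : 'I_m -> R) (i : 'I_m) : C :=
  \sum_(l < m | K l \subset S)
     #|unit_image (r l) U|%:R / #|unit_image (r l * r i) U|%:R *
     ramanujan (A := ann_quot (r l * r i)) (unit_image (r l * r i) U)
       (quot_char (x := r l * r i) chi).

Section Rationality.
Variable n : nat.

(* The identification (Z/n)^* = Gal(Q(z)/Q), under which h is the
   automorphism raising the primitive n-th root of unity z to the power h. *)
Definition cyclotomic_gal (L : splittingFieldType rat) (z : L)
    (H : {set {unit 'Z_n}}) : {set gal_of {:L}} :=
  [set s : gal_of {:L} |
    [exists h in H, s z == z ^+ (FinRing.uval h : 'Z_n)]].

Definition Zn_unit_image (R : finComUnitRingType) (H : {set {unit 'Z_n}}) :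
    {set {unit R}} :=
  [set u : {unit R} |
    [exists h in H, FinRing.uval u == (FinRing.uval h : 'Z_n)%:R]].

Definition rational_graph (T : finType) (C : numClosedFieldType)
    (L : splittingFieldType rat) (iota : {rmorphism L -> C})
    (K : {subfield L}) (e : rel T) : Prop :=
  forall a, eigenvalue (adjmx C e) a -> exists2 k, k \in K & a = iota k.

End Rationality.

(* Main.v *)
Require Import Defs.
From HB Require Import structures.
From mathcomp Require Import all_boot all_order all_fingroup all_algebra.
From mathcomp Require Import all_solvable all_field finmap.

Set Implicit Arguments.
Unset Strict Implicit.
Unset Printing Implicit Defensive.

Import GRing.Theory.
Local Open Scope ring_scope.

(* A generating character [chi] gives every additive character of [R] uniquely
   as [a |-> chi (x * a)], so orthogonality makes this an exact Fourier transform
   on [R], and the eigenvalues of [cayley S] are the sums of [chi (x * s)] over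
   [s] in [S].  Parts (1) and (2) follow by grouping these sums along U-orbits.
   For (3), the automorphism [z |-> z ^+ h] turns the eigenvalue of index [x]
   into that of index [h%:R * x]; all of them are fixed if and only if the
   indicator functions of [T] and [h%:R * T] have the same Fourier transform.
   For (4), both conditions amount to [R] being reduced.  If [x ^+ 2 = 0] with
   [x != 0], then [1 + x * R] consists of p-th powers of units, so [S] is a
   union of cosets of [x * R], which is then homogeneous, and [chi] sums to 0
   over [S].  If [R] is reduced, a maximal homogeneous set containing 0 is an
   ideal [M] with [1 - M] made of units, hence [M = 0]; and the eigenvalues
   split as products, over the primes [l] dividing [n], of sums of [N] l-th
   roots of unity with [N] prime to [l]: those sums are nonzero modulo [l]. *)

(** * Fourier analysis on a Frobenius ring *)

(** Translation by [b] permutes [A] and multiplies the sum by [f b], which is not 1. *)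
Lemma sum_char_eq0 (G : finZmodType) (C : numClosedFieldType) (f : G -> C)
    (A : {set G}) (b : G) :
    {morph f : x y / x + y >-> x * y} ->
    (forall a, (a + b \in A) = (a \in A)) -> f b != 1 ->
  \sum_(a in A) f a = 0.
Proof.
move=> fD Ab fb1.
have: \sum_(a in A) f a = f b * \sum_(a in A) f a.
  rewrite [LHS](reindex_inj (addIr b)) mulr_sumr.
  by apply: eq_big => [a | a _]; rewrite ?Ab // fD mulrC.
move/eqP; rewrite -subr_eq0 -{1}[\sum_(_ in _) _]mul1r -mulrBl mulf_eq0 subr_eq0.
by rewrite eq_sym (negPf fb1) => /eqP.
Qed.

Lemma sumT_char_eq0 (G : finZmodType) (C : numClosedFieldType) (f : G -> C) b :
  {morph f : x y / x + y >-> x * y} -> f b != 1 -> \sum_a f a = 0.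
Proof.
move=> fD fb1; rewrite -[RHS](sum_char_eq0 (A := [set: G]) fD _ fb1) => [|a].
  by apply: eq_bigl => a; rewrite inE.
by rewrite !inE.
Qed.

(** What the Fourier analysis needs of a generating character, freed from [n], [zeta] and [psi]. The
    last clause says that the kernel contains no non-zero principal ideal. *)
Definition faithful_char (R : finComUnitRingType) (C : numClosedFieldType)
    (chi : {ffun R -> C}) : Prop :=
  [/\ chi 0 = 1, {morph chi : x y / x + y >-> x * y}
    & forall r, (forall a, chi (r * a) = 1) -> r = 0].

Section FaithfulCharacter.

Variables (R : finComUnitRingType) (C : numClosedFieldType) (chi : {ffun R -> C}).
Hypothesis chiF : faithful_char chi.

Let chi0 : chi 0 = 1. Proof. by case: chiF. Qed.
Let chiD : {morph chi : x y / x + y >-> x * y}. Proof. by case: chiF. Qed.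
Let chi_faithful r : (forall a, chi (r * a) = 1) -> r = 0.
Proof. by case: chiF => _ _; apply. Qed.

Lemma chiN_mul a : chi (- a) * chi a = 1.
Proof. by rewrite -chiD addNr. Qed.

Lemma chi_neq0 a : chi a != 0.
Proof.
by apply: contra_eq_neq (chiN_mul a) => ->; rewrite mulr0 eq_sym oner_neq0.
Qed.

Lemma mulchar_inj : injective (mulchar chi).
Proof.
move=> x y /ffunP exy; apply/subr0_eq/chi_faithful => a.
have:= exy a; rewrite !ffunE => exya.
by rewrite mulrBl chiD exya mulrC chiN_mul.
Qed.

Lemma sum_chi_eq0 x : x != 0 -> \sum_a chi (x * a) = 0.
Proof.
move=> x0; have [b xb1] : exists b, chi (x * b) != 1.
  apply/existsP; rewrite -negb_forall; apply: contra x0 => /forallP x1.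
  by apply/eqP/chi_faithful => a; apply/eqP.
by apply: (@sumT_char_eq0 R C (fun a => chi (x * a)) _ _ xb1) => a c;
  rewrite mulrDr chiD.
Qed.

Lemma card_neq0 : #|R|%:R != 0 :> C.
Proof. by rewrite Num.Theory.pnatr_eq0 -lt0n; apply/card_gt0P; exists 0. Qed.

(** After the exchange of the sums, orthogonality leaves only the term at [b]. *)
Lemma fourier_inversion (f : R -> C) b :
  \sum_x chi (- (x * b)) * \sum_a f a * chi (x * a) = f b * #|R|%:R.
Proof.
under eq_bigr => x _ do rewrite mulr_sumr.
rewrite exchange_big /= (bigD1 b) //= [X in _ + X]big1 ?addr0 => [|a ab].
  under eq_bigr => x _ do rewrite mulrCA chiN_mul mulr1.
  by rewrite sumr_const mulr_natr.
transitivity (f a * \sum_x chi ((a - b) * x)).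
  rewrite mulr_sumr; apply: eq_bigr => x _.
  by rewrite mulrCA -chiD mulrBl addrC ![x * _]mulrC.
by rewrite sum_chi_eq0 ?mulr0 // subr_eq0.
Qed.

Lemma fourier_inj (f g : R -> C) :
    (forall x, \sum_a f a * chi (x * a) = \sum_a g a * chi (x * a)) -> f =1 g.
Proof.
move=> efg b; apply: (mulIf card_neq0); rewrite -!fourier_inversion.
by apply: eq_bigr => x _; rewrite efg.
Qed.

Lemma fourier_eq0 (f : R -> C) :
  (forall x, \sum_a f a * chi (x * a) = 0) -> f =1 fun=> 0.
Proof.
move=> f0; apply: fourier_inj => x; rewrite f0 big1 // => a _; exact: mul0r.
Qed.

(** By inversion [f] has a non-zero Fourier coefficient, at some [x]. The product of [f] with
    [mulchar chi x] is then a character with non-zero sum, hence trivial. *)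
Lemma add_charP (f : {ffun R -> C}) : add_char f <-> exists x, f = mulchar chi x.
Proof.
split=> [[f_neq0 fD] | [x ->]]; last first.
  by split=> [a | a b]; rewrite !ffunE ?chi_neq0 // mulrDr chiD.
have [x fx0] : exists x, \sum_a f a * chi (x * a) != 0.
  apply/existsP; rewrite -negb_forall; apply/negP => /forallP f0.
  by have /eqP := f_neq0 0; apply; apply: fourier_eq0 => x; apply/eqP.
exists (- x); apply/ffunP => a; rewrite ffunE mulNr.
apply: (mulIf (chi_neq0 (x * a))); rewrite chiN_mul; apply/eqP.
apply: contraNT fx0 => fa1; apply/eqP.
by apply: (@sumT_char_eq0 R C (fun b => f b * chi (x * b)) _ _ fa1) => b c;
  rewrite mulrDr chiD fD mulrACA.
Qed.

Lemma sum_enum_val (F : R -> C) : \sum_(i < #|R|) F (enum_val i) = \sum_x F x.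
Proof.
rewrite [RHS](reindex (@enum_val R R)) //.
by apply: onW_bij; apply: enum_val_bij.
Qed.

Lemma sum_cayley (S : {set R}) (F : R -> C) w :
  \sum_u F u * (cayley S u w)%:R = \sum_(s in S) F (w + s).
Proof.
rewrite (reindex_inj (addrI w)) [RHS]big_mkcond; apply: eq_bigr => s _.
by rewrite /cayley addrAC subrr add0r; case: (s \in S); rewrite ?mulr1 ?mulr0.
Qed.

(** Characters are eigenvectors. Conversely, the Fourier transform of an eigenvector is non-zero at
    some [x]; there the translates in the eigenvalue equation become factors [chi (- x * s)], whose
    sum must be [a]. *)
Lemma eigenvalue_cayleyP (S : {set R}) (a : C) :
  reflect (exists x, a = \sum_(s in S) chi (x * s))
          (eigenvalue (adjmx C (cayley S)) a).
Proof.
apply: (iffP eigenvalueP) => [[v vA v0] | [x ->]].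
  pose f u := v 0 (enum_rank u).
  have fA w : \sum_(s in S) f (w + s) = a * f w.
    have /rowP/(_ (enum_rank w)) := vA; rewrite !mxE => <-.
    rewrite -(sum_cayley S f w) -sum_enum_val; apply: eq_bigr => i _.
    by rewrite !mxE /f enum_valK enum_rankK.
  have [x fx0] : exists x, \sum_w f w * chi (x * w) != 0.
    apply/existsP; rewrite -negb_forall; apply: contra v0 => /forallP f0.
    apply/eqP/rowP => i; rewrite mxE -(enum_valK i).
    by apply: (@fourier_eq0 f) => x; apply/eqP.
  exists (- x); apply: (mulIf fx0); rewrite mulr_suml mulr_sumr.
  under eq_bigr => w _ do rewrite mulrA -fA mulr_suml.
  rewrite exchange_big; apply: eq_bigr => s _ /=.
  rewrite mulr_sumr (reindex_inj (addIr (- s))); apply: eq_bigr => w _ /=.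
  by rewrite addrNK mulrCA -chiD mulrBr mulNr addrC.
exists (\row_i chi (x * enum_val i)).
  apply/rowP => j; rewrite !mxE mulr_suml.
  under eq_bigr => i _ do rewrite !mxE.
  rewrite (sum_enum_val (fun u => chi (x * u) * (cayley S u (enum_val j))%:R)).
  rewrite (sum_cayley S (fun u => chi (x * u))); apply: eq_bigr => s _.
  by rewrite mulrDr chiD mulrC.
apply/negP => /eqP/rowP/(_ (enum_rank 0)); rewrite !mxE => /eqP.
by rewrite (negPf (chi_neq0 _)).
Qed.

End FaithfulCharacter.
(** * Orbits of the units and Ramanujan sums *)

Section Orbits.

Variables (R : finComUnitRingType) (U : {group {unit R}}).
Variables (m : nat) (K : 'I_m -> {set R}).
Hypothesis K_inj : injective K.
Hypothesis K_orbits : [set K i | i : 'I_m] = [set orbit 'U%act U x | x : R].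

Lemma unit_orbitP (x y : R) :
  reflect (exists2 u, u \in U & y = x * FinRing.uval u)
          (y \in orbit 'U%act U x).
Proof. exact: imsetP. Qed.

Lemma mulu_orbit x u : u \in U -> x * FinRing.uval u \in orbit 'U%act U x.
Proof. by move=> uU; apply/unit_orbitP; exists u. Qed.

Lemma orbit_familyE i x : x \in K i -> K i = orbit 'U%act U x.
Proof.
have : K i \in [set orbit 'U%act U y | y : R].
  by rewrite -K_orbits; apply/imsetP; exists i.
by case/imsetP=> y _ -> /orbit_eqP.
Qed.

Lemma orbit_family_cover x : exists i, x \in K i.
Proof.
have : orbit 'U%act U x \in [set K i | i : 'I_m].
  by rewrite K_orbits; apply/imsetP; exists x.
by case/imsetP => i _ xKi; exists i; rewrite -xKi orbit_refl.
Qed.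

Lemma orbit_family_uniq i j x : x \in K i -> x \in K j -> i = j.
Proof.
by move=> xi xj; apply: K_inj; rewrite (orbit_familyE xi) (orbit_familyE xj).
Qed.

Lemma orbit_family_partition : Defs.indexed_partition K.
Proof.
split=> //; rewrite K_orbits.
have -> : [set orbit 'U%act U x | x : R] = [set orbit 'U%act U x | x in [set: R]].
  by apply/setP => B; apply/imsetP/imsetP => -[x _ ->]; exists x; rewrite ?inE.
by apply: orbit_partition; apply/actsP => u _ y; rewrite !inE.
Qed.

Lemma orbit_family_opp u : u \in U -> FinRing.uval u = -1 -> symmetric_family K.
Proof.
move=> uU u1 i.
have KN a : a \in K i -> - a \in K i.
  by move=> /orbit_familyE ->; rewrite -mulrN1 -u1 mulu_orbit.
apply/setP => a; apply/imsetP/idP => [[b bK ->] | aK]; first exact: KN.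
by exists (- a); rewrite ?opprK // KN.
Qed.

(** The unit taking [a] to [b] can be moved onto [k], and [U] permutes [K j]. Since [x * a] is
    symmetric in [x] and [a], this yields both constancy conditions of a supercharacter theory. *)
Lemma sum_orbit_mul (V : nmodType) (F : R -> V) i j a b :
    a \in K i -> b \in K i ->
  \sum_(k in K j) F (k * a) = \sum_(k in K j) F (k * b).
Proof.
move=> aK; rewrite (orbit_familyE aK) => /unit_orbitP[u uU ->].
have inju : injective (fun x : R => x * FinRing.uval u).
  exact: mulIr (valP u).
rewrite (reindex_inj inju); apply: eq_big => x; last by rewrite mulrAC mulrA.
have E v y : v \in U -> y \in K j -> y * FinRing.uval v \in K j.
  by move=> vU yK; rewrite (orbit_familyE yK) mulu_orbit.
apply/idP/idP => [/(E u^-1%g _) | xK]; last exact: E.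
by rewrite groupV /= mulrK ?(valP u) //; apply.
Qed.

End Orbits.

Section UnitImage.

Variables (R : finComUnitRingType) (U : {group {unit R}}) (x : R).

(** Multiplication by [x] embeds R/Ann(x) in [R] and carries the image of [U] onto the orbit of [x].
    So orders of unit images are orbit sizes, and Ramanujan sums are sums of [chi] over orbits. *)
Let mulq (q : ann_quot x) : R := @generic_quotient.repr R (ann_quot x) q * x.

Let mulq_inj : injective mulq.
Proof.
move=> p q epq; rewrite -[p]ann_reprK -[q]ann_reprK; apply/eqP.
by rewrite eq_ann_quot mulrBl subr_eq0; apply/eqP.
Qed.

Lemma orbit_unit_image : orbit 'U%act U x = mulq @: unit_image x U.
Proof.
rewrite -imset_comp; apply: eq_imset => u /=.
by rewrite /mulq ann_repr_pi mulrC.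
Qed.

Lemma card_unit_image : #|unit_image x U| = #|orbit 'U%act U x|.
Proof. by rewrite orbit_unit_image (card_imset _ mulq_inj). Qed.

Lemma ramanujan_orbit (C : numClosedFieldType) (chi : {ffun R -> C}) :
  ramanujan (A := ann_quot x) (unit_image x U) (quot_char (x := x) chi) =
  \sum_(y in orbit 'U%act U x) chi y.
Proof.
rewrite orbit_unit_image big_imset /= => [|p q _ _ /mulq_inj //].
by apply: eq_bigr => q _; rewrite /quot_char ffunE mulrC.
Qed.

End UnitImage.

(** The fibres of [u |-> x * u] over the orbit are cosets of the stabilizer. *)
Lemma sum_orbit_unit (R : finComUnitRingType) (U : {group {unit R}})
    (C : numClosedFieldType) (F : R -> C) x :
  \sum_(y in orbit 'U%act U x) F y =
  #|orbit 'U%act U x|%:R / #|U|%:R * \sum_(u in U) F (x * FinRing.uval u).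
Proof.
have fiber y : y \in orbit 'U%act U x ->
    #|[set u in U | x * FinRing.uval u == y]| = #|'C_U[x | 'U]%g|.
  case/imsetP=> u uU ->; rewrite -[RHS](card_rcoset _ u) -amove_act ?subsetT //.
rewrite -(card_orbit_stab 'U%act U x) natrM invfM mulrA mulfV ?mul1r; last first.
  rewrite Num.Theory.pnatr_eq0 -lt0n; apply/card_gt0P.
  by exists x; apply: orbit_refl.
apply: (canRL (mulKf _)).
  by rewrite Num.Theory.pnatr_eq0 -lt0n cardG_gt0.
rewrite [RHS](partition_big_imset (fun u => x * FinRing.uval u)) mulr_sumr /=.
apply: eq_bigr => y /fiber <-; rewrite -sum1_card natr_sum mulr_suml.
rewrite (eq_bigl (fun u => (u \in U) && (x * FinRing.uval u == y))).
  by apply: eq_bigr => u /andP[_ /eqP ->]; rewrite mul1r.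
by move=> u; rewrite inE.
Qed.
Lemma sum_imfset (T : finType) (Y : choiceType) (V : nmodType) (f : T -> Y)
    (A : {set T}) (F : Y -> V) :
  injective f ->
  \sum_(y <- [fset f x | x in A]%fset) F y = \sum_(x in A) F (f x).
Proof.
move=> injf; rewrite (perm_big [seq f x | x <- enum A]) /=.
  by rewrite big_map big_enum.
apply: uniq_perm => [||y]; rewrite ?fset_uniq ?(map_inj_uniq injf) ?enum_uniq //.
by apply/imfsetP/mapP => -[x xA ->]; exists x; rewrite ?mem_enum // in xA *.
Qed.

(** * Supercharacters and eigenvalues of unitary Cayley graphs *)

Section OrbitCharacters.

Variables (R : finComUnitRingType) (U : {group {unit R}}).
Variables (m : nat) (K : 'I_m -> {set R}) (r : 'I_m -> R).
Hypothesis K_inj : injective K.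
Hypothesis K_orbits : [set K i | i : 'I_m] = [set orbit 'U%act U x | x : R].
Hypothesis rK : forall i, r i \in K i.
Variables (C : numClosedFieldType) (chi : {ffun R -> C}).
Hypothesis chiF : faithful_char chi.

Lemma orbit_supercharacter :
  supercharacter_theory K (fun i => [fset mulchar chi x | x in K i]%fset).
Proof.
have chi_inj := mulchar_inj chiF.
split; [split; [exact: orbit_family_partition K_inj K_orbits | split] | | |].
- move=> i; apply/fset0Pn; exists (mulchar chi (r i)).
  by apply/imfsetP; exists (r i) => /=.
- move=> i j ij; apply/fdisjointP => _ /imfsetP[x /= xi ->].
  apply: contra ij => /imfsetP[y /= yj /chi_inj exy].
  by apply/eqP/(orbit_family_uniq K_inj K_orbits xi); rewrite exy.
- move=> f; rewrite (add_charP chiF); split=> [[x ->] | [i /imfsetP[x _ ->]]].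
    have [i xi] := orbit_family_cover K_orbits x.
    by exists i; apply/imfsetP; exists x.
  by exists x.
- have [i xi] := orbit_family_cover K_orbits 0; exists i.
  apply/setP => x; rewrite (orbit_familyE K_orbits xi) inE.
  apply/unit_orbitP/eqP => [[u _ ->] | ->]; first by rewrite mul0r.
  by exists 1%g; rewrite ?group1 ?mul0r.
- move=> i j a b aK bK; rewrite !sum_imfset //.
  under eq_bigr => x _ do rewrite ffunE.
  under [RHS]eq_bigr => x _ do rewrite ffunE.
  exact: (sum_orbit_mul K_orbits (fun y => chi y) i aK bK).
move=> i j _ _ /imfsetP[x /= xi ->] /imfsetP[y /= yi ->].
under eq_bigr => a _ do rewrite ffunE mulrC.
under [RHS]eq_bigr => a _ do rewrite ffunE mulrC.
exact: (sum_orbit_mul K_orbits (fun y => chi y) j xi yi).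
Qed.

Lemma sum_unitary (S : {set R}) (F : R -> C) :
    unitary U S ->
  \sum_(s in S) F s = \sum_(l < m | K l \subset S) \sum_(s in K l) F s.
Proof.
move=> US.
have KS l x : x \in K l -> x \in S -> K l \subset S.
  move=> xl xS; apply/subsetP => y; rewrite (orbit_familyE K_orbits xl).
  case/unit_orbitP => u uU ->; rewrite -US mulrC.
  by apply/imset2P; exists u x.
rewrite (exchange_big_dep (mem S)) => [|l s lS sl]; last exact: (subsetP lS).
apply: eq_bigr => s sS; have [l sl] := orbit_family_cover K_orbits s.
rewrite (big_pred1 l) // => k; apply/andP/eqP => [[_ sk] | ->].
  exact: (orbit_family_uniq K_inj K_orbits sk sl).
by split=> //; apply: KS sl sS.
Qed.

(** The sum of [chi (r i * s)] over [K l] and the Ramanujan sum at [r l * r i] are multiples of the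
    same sum over [U]; the quotient of orders in [eigen_sum] accounts for the two orbit sizes. *)
Lemma cayley_eigen_sum (S : {set R}) (a : C) :
    unitary U S -> eigenvalue (adjmx C (cayley S)) a ->
  exists i, a = eigen_sum chi U S K r i.
Proof.
move=> US /(eigenvalue_cayleyP chiF)[x ->].
have [i xi] := orbit_family_cover K_orbits x; exists i.
rewrite sum_unitary //; apply: eq_bigr => l _.
rewrite ramanujan_orbit !card_unit_image !sum_orbit_unit.
have U0 : #|U|%:R != 0 :> C by rewrite Num.Theory.pnatr_eq0 -lt0n cardG_gt0.
have orbit0 y : #|orbit 'U%act U y|%:R != 0 :> C.
  rewrite Num.Theory.pnatr_eq0 -lt0n; apply/card_gt0P.
  by exists y; apply: orbit_refl.
rewrite mulrA [X in X * _](_ : _ = #|orbit 'U%act U (r l)|%:R / #|U|%:R); last first.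
  by rewrite mulrA divfK.
under eq_bigr => s _ do rewrite mulrC.
rewrite (sum_orbit_mul K_orbits (fun y => chi y) l xi (rK i)).
rewrite (orbit_familyE K_orbits (rK l)) sum_orbit_unit.
by congr (_ * _); apply: eq_bigr => u _; rewrite mulrAC.
Qed.

End OrbitCharacters.
(** * Rationality *)

(** As a root of X^n - 1, [z] is a root of ['Phi_d] for some divisor [d] of [n]; then [z ^+ d = 1],
    and primitivity forces [d = n]. *)
Lemma root_Cyclotomic (F : fieldType) n (z : F) :
  n.-primitive_root z -> root (map_poly intr 'Phi_n) z.
Proof.
move=> prim_z; have n_gt0 := prim_order_gt0 prim_z.
have : root (map_poly intr (\prod_(d <- divisors n) 'Phi_d)) z.
  rewrite prod_Cyclotomic // rmorphB rmorph1 /= map_polyXn.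
  by rewrite rootE !hornerE (prim_expr_order prim_z) subrr.
rewrite rmorph_prod /root horner_prod /= big_seq prodf_seq_eq0.
case/hasP => d dn /andP[_ zd]; move: dn; rewrite -dvdn_divisors // => dn.
have zd1 : z ^+ d == 1.
  have : root (map_poly intr (\prod_(e <- divisors d) 'Phi_e)) z.
    have d_gt0 := dvdn_gt0 n_gt0 dn.
    rewrite rmorph_prod (big_rem d) /= ?rootM ?[root _ z]zd //.
    by rewrite -dvdn_divisors ?dvdnn.
  rewrite prod_Cyclotomic ?(dvdn_gt0 n_gt0 dn) // rmorphB rmorph1 /= map_polyXn.
  by rewrite rootE !hornerE subr_eq0.
suff -> : n = d by [].
by apply/eqP; rewrite eqn_dvd dn andbT (prim_order_dvd prim_z).
Qed.

(** This carries the irreducibility of ['Phi_n] over the rationals from [algC] to any [F]: the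
    common root [z] makes the gcd non-constant, which gives a common root [w] in [algC], a primitive
    [n]-th root with minimal polynomial ['Phi_n]. *)
Lemma Cyclotomic_dvd (F : fieldType) (f : {rmorphism rat -> F}) n (z : F)
    (q : {poly rat}) :
  n.-primitive_root z -> root (map_poly f q) z -> map_poly intr 'Phi_n %| q.
Proof.
move=> prim_z qz0; set P := map_poly _ _.
have PE (E : fieldType) (g : {rmorphism rat -> E}) :
      map_poly g P = map_poly intr 'Phi_n.
  by rewrite -map_poly_comp; apply: eq_map_poly => k /=; rewrite rmorph_int.
have Pz0 : root (map_poly f P) z by rewrite PE root_Cyclotomic.
have : size (gcdp P q) != 1.
  have := root_gcd (map_poly f P) (map_poly f q) z; rewrite Pz0 qz0 -gcdp_map.
  apply: contraTneq => g1; have /size_poly1P[c c0 ->] := introT eqP g1.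
  by rewrite map_polyC rootC fmorph_eq0 (negPf c0).
rewrite -(size_map_poly (ratr : {rmorphism rat -> algC})) gcdp_map.
case/closed_rootP => w; rewrite root_gcd => /andP[Pw qw].
have [v prim_v] := C_prim_root_exists (prim_order_gt0 prim_z).
have prim_w : n.-primitive_root w.
  by move: Pw; rewrite PE (Cintr_Cyclotomic prim_v) root_cyclotomic.
have [p [wp _] pP] := minCpolyP w; rewrite pP in qw.
suff -> : P = p by [].
apply: (map_inj_poly (fmorph_inj (ratr : {rmorphism rat -> algC}))) => //.
  by rewrite rmorph0.
by rewrite PE -wp (minCpoly_cyclotomic prim_w) (Cintr_Cyclotomic prim_w).
Qed.

(** The minimal polynomial of [z] is a multiple of ['Phi_n], so the primitive root [z ^+ k] is a
    conjugate of [z], and normality of [L] gives the automorphism. *)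
Lemma cyclotomic_gal_exists n (L : splittingFieldType rat) (z : L) k :
  n.-primitive_root z -> coprime k n -> exists s : gal_of {:L}, s z = z ^+ k.
Proof.
move=> prim_z kn; have /polyOver1P[q Dq] := minPolyOver 1 z.
have [||||s _ sz] := @normalField_root_minPoly _ L 1%AS {:L}%AS z (z ^+ k).
- exact: sub1v.
- exact: normalFieldf.
- exact: memvf.
- have := root_minPoly 1 z; rewrite Dq => /(Cyclotomic_dvd prim_z)/dvdpP[c ->].
  rewrite rmorphM rootM /= -map_poly_comp /=.
  rewrite (eq_map_poly (g := intr)) => [|j]; last exact: scaler_int.
  by rewrite root_Cyclotomic ?orbT // prim_root_exp_coprime.
by exists s.
Qed.
Section ZnExponents.

Variables (F : fieldType) (n : nat) (z : F).
Hypotheses (n_gt1 : (1 < n)%N) (prim_z : n.-primitive_root z).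

Lemma expr_ZnD (x y : 'Z_n) : z ^+ (x + y : 'Z_n)%R = z ^+ x * z ^+ y.
Proof. by rewrite /= [X in (_ %% X)%N]Zp_cast // (prim_expr_mod prim_z) exprD. Qed.

Lemma expr_ZnM (x y : 'Z_n) : z ^+ (x * y : 'Z_n)%R = z ^+ x ^+ y.
Proof. by rewrite /= [X in (_ %% X)%N]Zp_cast // (prim_expr_mod prim_z) exprM. Qed.

Lemma expr_Zn_eq1 (x : 'Z_n) : (z ^+ x == 1) = (x == 0).
Proof.
rewrite -(prim_order_dvd prim_z) -val_eqE /= /dvdn modn_small //.
by rewrite -[X in (_ < X)%N](Zp_cast n_gt1).
Qed.

End ZnExponents.

Section GeneratingFunctional.

Variables (R : finComUnitRingType) (n : nat) (psi : R -> 'Z_n).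
Hypothesis psiL : Zn_linear psi.

Lemma Zn_linearD a b : psi (a + b) = psi a + psi b.
Proof. by have := psiL 1 a b; rewrite mul1r mulr1n. Qed.

Lemma Zn_linear0 : psi 0 = 0.
Proof. by apply: (addIr (psi 0)); rewrite -Zn_linearD !add0r. Qed.

Lemma Zn_linearM (h : 'Z_n) a : psi (h%:R * a) = h * psi a.
Proof. by have := psiL h a 0; rewrite Zn_linear0 !addr0 mulr_natl. Qed.

End GeneratingFunctional.

Lemma char_ring_gt1 (R : finComUnitRingType) n :
  (0 < n)%N -> (forall a : R, a *+ n = 0) -> (1 < n)%N.
Proof.
case: n => [|[|n]] // _ /(_ 1) /eqP; by rewrite mulr1n oner_eq0.
Qed.

Lemma generating_character_faithful (R : finComUnitRingType)
    (C : numClosedFieldType) n (zeta : C) (chi : {ffun R -> C}) :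
    (1 < n)%N -> n.-primitive_root zeta -> generating_character n zeta chi ->
  faithful_char chi.
Proof.
move=> n_gt1 prim [psi [psiL psi_ker] chiE].
split=> [|a b|x x1]; first by rewrite chiE (Zn_linear0 psiL) expr0.
  by rewrite !chiE (Zn_linearD psiL) expr_ZnD.
(* The kernel condition is applied to the principal ideal of [x]: [psi] vanishes there because
   [zeta] has order exactly [n]. *)
have I0 : [set x * a | a : R] = [set 0].
  apply: psi_ker => [|_ /imsetP[a _ ->]]; last first.
    by apply/eqP; rewrite -(expr_Zn_eq1 n_gt1 prim) -chiE x1.
  split=> [|a _ _ /imsetP[b _ ->] /imsetP[c _ ->]].
    by apply/imsetP; exists 0; rewrite ?mulr0.
  by apply/imsetP; exists (a * b + c); rewrite // mulrDr mulrCA.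
by apply/set1P; rewrite -I0; apply/imsetP; exists 1; rewrite ?mulr1.
Qed.

Lemma unitaryP (R : finComUnitRingType) (V : {set {unit R}}) (S : {set R}) :
    1%g \in V ->
  reflect (unitary V S)
          [forall v in V, [set FinRing.uval v * s | s in S] == S].
Proof.
move=> V1; apply: (iffP forall_inP) => [VS | VS v vV].
  apply/setP => a; apply/imset2P/idP => [[v s vV sS ->] | aS].
    by rewrite -(eqP (VS v vV)); apply: imset_f.
  by exists 1%g a; rewrite ?mul1r.
rewrite eqEcard card_imset ?leqnn ?andbT; last exact: mulrI (valP v).
by apply/subsetP => _ /imsetP[s sS ->]; rewrite -VS; apply/imset2P; exists v s.
Qed.

Section Rational.

Variables (R : finComUnitRingType) (C : numClosedFieldType) (n : nat).
Variables (zeta : C) (chi : {ffun R -> C}).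
Variables (L : splittingFieldType rat) (z : L) (iota : {rmorphism L -> C}).
Variables (F : {subfield L}) (H : {group {unit 'Z_n}}) (T : {set R}).
Hypotheses (n_gt1 : (1 < n)%N) (nR0 : forall a : R, a *+ n = 0).
Hypotheses (prim_zeta : n.-primitive_root zeta) (prim_z : n.-primitive_root z).
Hypothesis chi_gen : generating_character n zeta chi.
Hypotheses (iota_z : iota z = zeta) (fixF : fixedField (cyclotomic_gal z H) = F).

(** As [n] kills [R], reduction modulo [n] is invisible in [R], so the inverse of [h] in ['Z_n] maps
    to an inverse in [R]. *)
Lemma Zn_unit_natr (h : {unit 'Z_n}) :
  ((FinRing.uval h : 'Z_n)%:R : R) \is a GRing.unit.
Proof.
have hh : FinRing.uval h * FinRing.uval h^-1%g = 1 by rewrite mulrV ?(valP h).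
have natrM_Zn (x y : 'Z_n) : ((x * y)%R%:R : R) = x%:R * y%:R.
  rewrite -natrM /= [X in (_ %% X)%N]Zp_cast // [in RHS](divn_eq (x * y)%N n).
  by rewrite natrD natrM (_ : n%:R = 0) ?mulr0 ?add0r // nR0.
apply/unitrPr; exists ((FinRing.uval h^-1%g : 'Z_n)%:R).
by rewrite -natrM_Zn hh.
Qed.

Lemma rational_unitary :
  rational_graph iota F (cayley T) <-> unitary (Zn_unit_image R H) T.
Proof.
have chiF := generating_character_faithful n_gt1 prim_zeta chi_gen.
have [psi [psiL _] chiE] := chi_gen.
(* The eigenvalues are written inside [L], where the Galois group acts. *)
pose lam x := \sum_(t in T) z ^+ psi (x * t).
have lamE x : iota (lam x) = \sum_(t in T) chi (x * t).
  rewrite rmorph_sum; apply: eq_bigr => t _.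
  by rewrite chiE rmorphXn /= iota_z.
have lam_gal (s : gal_of {:L}) (h : 'Z_n) x :
    s z = z ^+ h -> s (lam x) = lam (h%:R * x).
  move=> sz; rewrite rmorph_sum; apply: eq_bigr => t _.
  by rewrite -mulrA (Zn_linearM psiL) mulrC expr_ZnM // rmorphXn /= sz exprAC.
have H1 : 1%g \in Zn_unit_image R H.
  rewrite inE; apply/exists_inP; exists 1%g; rewrite ?group1 //.
(* Under [iota], the two values of [lam] are the Fourier transforms at [x] of the indicator
   functions of [vT] and [T]. *)
have fourierT (v : {unit R}) : [set FinRing.uval v * s | s in T] = T <->
    forall x, lam (FinRing.uval v * x) = lam x.
  pose ind (A : {set R}) (a : R) : C := (a \in A)%:R.
  have indE (A : {set R}) x :
      \sum_a ind A a * chi (x * a) = \sum_(a in A) chi (x * a).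
    rewrite [RHS]big_mkcond; apply: eq_bigr => a _; rewrite /ind.
    by case: (a \in A); rewrite ?mul1r ?mul0r.
  have vTE x : iota (lam (FinRing.uval v * x)) =
      \sum_(a in [set FinRing.uval v * s | s in T]) chi (x * a).
    rewrite lamE big_imset /= => [|a b _ _]; last exact/mulrI/(valP v).
    by apply: eq_bigr => t _; rewrite mulrCA mulrA.
  split=> [vT x | lamv].
    by apply: (fmorph_inj iota); rewrite vTE vT lamE.
  have eq_ind : ind [set FinRing.uval v * s | s in T] =1 ind T.
    by apply: (fourier_inj chiF) => x; rewrite !indE -vTE lamv lamE.
  apply/setP => a; have := eq_ind a; rewrite /ind.
  case: (_ \in _); case: (_ \in _) => // /eqP; first by rewrite oner_eq0.
  by rewrite eq_sym oner_eq0.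
rewrite (rwP (unitaryP T H1)).
split=> [rat | /forall_inP unitH a].
  apply/forall_inP => v; rewrite inE => /exists_inP[h hH /eqP vh].
  apply/eqP/fourierT => x; rewrite vh.
  have ch : coprime (FinRing.uval h : 'Z_n) n.
    by rewrite coprime_sym -unitZpE // natr_Zp (valP h).
  have [s sz] := cyclotomic_gal_exists prim_z ch.
  rewrite -(lam_gal _ _ _ sz).
  have [|k kF] := rat (iota (lam x)).
    by apply/(eigenvalue_cayleyP chiF); exists x; rewrite lamE.
  (* Rationality puts [lam x] in the fixed field, so the automorphism attached to [h] fixes it. *)
  move/fmorph_inj => lamk; rewrite -fixF in kF.
  have [_] := mem_fixedFieldP kF; rewrite lamk; apply.
  by rewrite inE; apply/exists_inP; exists h; rewrite ?sz.
case/(eigenvalue_cayleyP chiF)=> x ->; exists (lam x); last by rewrite lamE.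
rewrite -fixF; apply/fixedFieldP => [|s]; first exact: memvf.
rewrite inE => /exists_inP[h hH /eqP sz]; rewrite (lam_gal _ _ _ sz).
pose v : {unit R} := FinRing.unit R (Zn_unit_natr h).
have vH : v \in Zn_unit_image R H by rewrite inE; apply/exists_inP; exists h.
exact: (proj1 (fourierT v) (eqP (unitH v vH)) x).
Qed.

End Rational.
(** * Nonvanishing of the eigenvalues over a reduced ring *)

(** All binomial coefficients but the two extreme ones are divisible by [l]. The cofactor of [l] is
    explicit so that its integrality can be checked later. *)
Lemma exprD_prime (A : comNzRingType) l (a b : A) : prime l ->
  (a + b) ^+ l = a ^+ l + b ^+ l +
    (\sum_(i < l.-1) (a ^+ (l - i.+1) * b ^+ i.+1) *+ ('C(l, i.+1) %/ l)) *+ l.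
Proof.
case: l => // l l_pr; rewrite exprDn big_ord_recl big_ord_recr /= /bump /=.
rewrite subn0 subnn bin0 binn !expr0 !mulr1 mul1r !mulr1n -addrA; congr (_ + _).
rewrite addrC; congr (_ + _); rewrite -sumrMnl; apply: eq_bigr => i _ /=.
by rewrite -mulrnA divnK // prime_dvd_bin //= !ltnS ltn_ord.
Qed.

(** A monic integral equation of degree [k] for the inverse of [l], multiplied by [l ^+ k], reads
    [m * l + 1 = 0] over the integers. *)
Lemma not_integral_invn (C : numClosedFieldType) l (z : C) :
  prime l -> integralOver intr z -> l%:R * z != 1.
Proof.
move=> l_pr [p p_monic pz0]; apply/eqP => lz1.
have p_gt0 : (0 < size p)%N by rewrite size_poly_gt0 monic_neq0.
pose k := (size p).-1.
have lz i : (i <= k)%N -> z ^+ i * l%:R ^+ k = l%:R ^+ (k - i).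
  move=> ik; rewrite -{1}(subnK ik) exprD mulrCA -exprMn [z * _]mulrC lz1.
  by rewrite expr1n mulr1.
have : (map_poly intr p).[z] * l%:R ^+ k = 0 by rewrite (eqP pz0) mul0r.
rewrite horner_coef size_map_inj_poly //; last exact: intr_inj.
rewrite -(prednK p_gt0) -/k big_ord_recr /= mulrDl coef_map /=.
rewrite -[p`_k]/(lead_coef p) (monicP p_monic) mul1r lz // subnn expr0 mulr_suml.
pose m := \sum_(i < k) p`_i * l%:R ^+ (k - i.+1) : int.
have -> : \sum_(i < k) (map_poly intr p)`_i * z ^+ i * l%:R ^+ k = (m * l%:R)%:~R.
  rewrite mulr_suml rmorph_sum; apply: eq_bigr => i _ /=.
  rewrite coef_map -mulrA lz 1?ltnW // -(subnSK (ltn_ord i)) exprSr.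
  by rewrite !rmorphM rmorphXn /= !rmorph_nat !mulrA.
move/eqP; rewrite -[1]/(1%:~R) -rmorphD /= intr_eq0.
move=> /eqP ml1; have : (l%:Z %| 1)%Z.
  apply/dvdzP; exists (- m); rewrite mulNr; apply/eqP.
  by rewrite -addr_eq0 addrC -[X in _ * X]natz ml1.
by rewrite dvdzE /= dvdn1; case: l l_pr {lz1 lz ml1 m} => [|[]].
Qed.

Lemma integral_exp (C : numClosedFieldType) (z : C) k :
  integralOver (intr : int -> C) z -> integralOver (intr : int -> C) (z ^+ k).
Proof.
move=> zint; elim: k => [|k IHk]; first exact: integral1.
by rewrite exprS; apply: integral_mul.
Qed.

Lemma integral_sum (C : numClosedFieldType) (I : Type) (s : seq I) (P : pred I)
    (F : I -> C) :
  (forall i, P i -> integralOver (intr : int -> C) (F i)) ->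
  integralOver (intr : int -> C) (\sum_(i <- s | P i) F i).
Proof.
by move=> Fint; apply: big_ind => //; [exact: integral0 | exact: integral_add].
Qed.

(** On algebraic integers the [l]-th power map is additive modulo [l]. *)
Lemma sum_exp_prime (C : numClosedFieldType) (I : Type) (s : seq I) (P : pred I)
    (F : I -> C) l :
    prime l -> (forall i, integralOver (intr : int -> C) (F i)) ->
  exists2 y, integralOver (intr : int -> C) y &
    (\sum_(i <- s | P i) F i) ^+ l = \sum_(i <- s | P i) F i ^+ l + y *+ l.
Proof.
move=> l_pr Fint; elim: s => [|i s [y yint IHs]].
  exists 0; first exact: integral0.
  by rewrite !big_nil expr0n mul0rn addr0; case: l l_pr.
rewrite !big_cons; case: (P i); last by exists y.
rewrite exprD_prime // IHs; set Y := \sum_(j < _) _.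
exists (y + Y); last by rewrite mulrnDl !addrA.
apply: integral_add => //; apply: integral_sum => j _.
rewrite -mulr_natr; apply: integral_mul; last exact: integral_nat.
by apply: integral_mul; apply: integral_exp => //; apply: integral_sum.
Qed.

(* The [l]-th power of the sum is congruent modulo [l] to the number of its
   terms. *)
Lemma sum_unity_roots_neq0 (C : numClosedFieldType) (I : finType) (A : {set I})
    (F : I -> C) l :
    prime l -> (forall i, F i ^+ l = 1) -> ~~ (l %| #|A|)%N ->
  \sum_(i in A) F i != 0.
Proof.
move=> l_pr Fl1 lA; apply/eqP => sum0.
have Fint i : integralOver (intr : int -> C) (F i).
  exists ('X^l - 1); first by rewrite monicXnsubC ?prime_gt0.
  by rewrite rmorphB rmorph1 /= map_polyXn rootE !hornerE Fl1 subrr.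
have [y yint] := sum_exp_prime (index_enum I) (mem A) l_pr Fint.
rewrite sum0 expr0n eqn0Ngt prime_gt0 // mulr0n.
under [in X in _ = X + _]eq_bigr => i _ do rewrite Fl1.
rewrite sumr_const => Al.
(* Bezout gives [a * l = 1 + b * #|A|]. The zero sum means [#|A| + l * y = 0], so [a + b * y] would
   be an integral inverse of [l]. *)
have /(coprimeP _ (prime_gt0 l_pr))[[a b] /= ab] : coprime l #|A|.
  by rewrite prime_coprime.
have : l%:R * (a%:R + b%:R * y) != 1.
  apply: not_integral_invn => //; apply: integral_add; first exact: integral_nat.
  by apply: integral_mul => //; apply: integral_nat.
have baA : (a * l = 1 + b * #|A|)%N.
  by rewrite -ab subnK //; apply: ltnW; rewrite -subn_gt0 ab.
rewrite mulrDr mulrCA -natrM mulnC baA natrD natrM -addrA -mulrDr.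
by rewrite [l%:R * y]mulr_natl -Al mulr0 addr0 eqxx.
Qed.

Definition reduced (R : pzRingType) : Prop := forall x : R, x ^+ 2 = 0 -> x = 0.

(** The exponent is raised to a power of 2, which [reduced] then halves repeatedly. *)
Lemma reduced_expr_eq0 (R : pzRingType) (x : R) k : reduced R -> x ^+ k = 0 -> x = 0.
Proof.
move=> redR xk; have : x ^+ (2 ^ k) = 0.
  by rewrite -(subnK (ltnW (ltn_expl k (leqnn 2)))) exprD xk mulr0.
by elim: k {xk} => [|k IHk] //; rewrite expnSr exprM => /redR.
Qed.

Section ReducedSpectrum.

Variables (R : finComUnitRingType) (U : {group {unit R}}).
Hypothesis redR : reduced R.
(** [U] is a product along the decomposition of [R] into [fR] and [(1 - f)R]. *)
Hypothesis U_split : forall f : R, f * f = f -> {in U &, forall u v, exists2 w,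
  w \in U & f * FinRing.uval w = f * FinRing.uval u /\
            (1 - f) * FinRing.uval w = (1 - f) * FinRing.uval v}.

(** The ring [eR] is reduced and killed by [l], so its only root of unity of [l]-power order is [e].
    Hence a Sylow [l]-subgroup of [U] fixes [e], and the index of the stabilizer is prime to [l]. *)
Lemma reduced_orbit_idem_card l (e : R) :
  prime l -> e * e = e -> e *+ l = 0 -> ~~ (l %| #|orbit 'U%act U e|)%N.
Proof.
move=> l_pr ee el0; rewrite card_orbit.
have [P sylP] := Sylow_exists l U; have [sPU lP _] := and3P sylP.
suff sPC : P \subset 'C_U[e | 'U]%g.
  apply: contraL (sylP) => lU; apply/negP => /and3P[_ _].
  rewrite p'natE // -(Lagrange_index (subsetIl _ _) sPC) dvdn_mulr //.
(* The [l]-th power map is additive on [eR], so [e * (x - 1)] has zero [l]-th power. *)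
have root1 (x : R) : e * x ^+ l = e -> e * x = e.
  move=> exl; have := exprD_prime 1 (x - 1) l_pr; rewrite [1 + _]addrC subrK.
  move/(congr1 ( *%R e)); rewrite expr1n exl !mulrDr mulr1.
  rewrite [e * (_ *+ l)]mulrnAr -mulrnAl el0 mul0r addr0 -{1}[e]addr0 => /addrI e0.
  have /(reduced_expr_eq0 redR) : (e * (x - 1)) ^+ l = 0.
    case: l l_pr {lP sylP el0 exl} e0 => // l _ e0.
    by rewrite exprMn exprS -mulrA mulrCA -e0 mulr0.
  by move=> /eqP; rewrite mulrBr mulr1 subr_eq0 => /eqP.
apply/subsetP => u uP; rewrite inE (subsetP sPU) //; apply/astab1P.
have : (u ^+ (l ^ logn l #[u]) = 1)%g.
  by rewrite -p_part (part_pnat_id (mem_p_elt lP uP)) expg_order.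
move/(congr1 (fun v => e * FinRing.uval v)); rewrite /= FinRing.val_unitX mulr1.
elim: (logn l _) => [|k IHk]; first by rewrite expr1.
by rewrite expnSr exprM => /root1.
Qed.

(** By [U_split] the units act independently on [f] and on [g], which lies in [(1 - f)R]. Every
    element of the orbit of [f + g] is thus uniquely a sum over the two orbits, and the character
    sum factors. *)
Lemma sum_orbitD (C : numClosedFieldType) (F : R -> C) (f g : R) :
    {morph F : x y / x + y >-> x * y} -> f * f = f -> g * g = g -> f * g = 0 ->
  \sum_(y in orbit 'U%act U (f + g)) F y =
  (\sum_(a in orbit 'U%act U f) F a) * \sum_(b in orbit 'U%act U g) F b.
Proof.
move=> FD ff gg fg.
have gf1 x : g * x = g * ((1 - f) * x).
  by rewrite mulrA mulrBr mulr1 mulrC [g * f]mulrC fg subr0 mulrC.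
have -> : orbit 'U%act U (f + g) =
    [set p.1 + p.2 | p in setX (orbit 'U%act U f) (orbit 'U%act U g)].
  apply/setP => y; apply/unit_orbitP/imsetP => [[u uU ->] | [[a b] /setXP[/= ]]].
    exists (f * FinRing.uval u, g * FinRing.uval u); last by rewrite mulrDl.
    by rewrite inE /= !mulu_orbit.
  move=> /unit_orbitP[u uU ->] /unit_orbitP[v vU ->] ->.
  have [w wU [fw gw]] := U_split ff uU vU; exists w => //.
  by rewrite mulrDl fw [g * FinRing.uval w]gf1 gw -gf1.
rewrite big_imset => [|[a b] [a' b']] /=; last first.
  move=> /setXP[/unit_orbitP[u _ ->] /unit_orbitP[v _ ->]].
  move=> /setXP[/unit_orbitP[u' _ ->] /unit_orbitP[v' _ ->]] /= E.
  have := congr1 ( *%R f) E; have := congr1 ( *%R g) E.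
  by rewrite !mulrDr !mulrA ff gg fg [g * f]mulrC fg !mul0r !addr0 !add0r => -> ->.
rewrite big_distrlr /= (pair_big (mem (orbit 'U%act U f)) (mem (orbit 'U%act U g))) /=.
by apply: eq_big => [[a b] | [a b] _]; rewrite ?in_setX //= FD.
Qed.

(** Strong induction on [d]. For [d = 1] the orbit is zero alone; for prime [d] the sum consists of
    [d]-th roots of unity; otherwise [d] can be lowered or [e] splits into orthogonal idempotents
    killed by smaller integers. *)
Lemma sum_orbit_idem_neq0 (C : numClosedFieldType) (F : R -> C) d (e : R) :
    {morph F : x y / x + y >-> x * y} -> F 0 = 1 ->
    e * e = e -> (0 < d)%N -> e *+ d = 0 ->
  \sum_(y in orbit 'U%act U e) F y != 0.
Proof.
move=> FD F0; elim/ltn_ind: d e => d IHd e ee d_gt0 ed0.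
have [d1 | d_neq1] := eqVneq d 1%N.
  rewrite d1 mulr1n in ed0; rewrite ed0 (big_pred1 0) ?F0 ?oner_neq0 // => y.
  by apply/unit_orbitP/eqP => [[u _ ->] | ->]; [|exists 1%g]; rewrite ?mul0r.
have l_pr : prime (pdiv d) by rewrite pdiv_prime // ltn_neqAle eq_sym d_neq1.
have := divnK (pdiv_dvd d); move: l_pr; set l := pdiv d; set c := (d %/ l)%N.
move=> l_pr dE; have c_gt0 : (0 < c)%N.
  by move: d_gt0; rewrite -dE muln_gt0 => /andP[].
have [c1 | c_neq1] := eqVneq c 1%N.
  have el0 : e *+ l = 0 by rewrite -ed0 -dE c1 mul1n.
  (* [F y] depends only on [e * y] on the orbit, where [l] kills it. *)
  have Fel y : F (e * y) ^+ l = 1.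
    have FX k : F (e * y) ^+ k = F (e * y *+ k).
      by elim: k => [|k IHk]; rewrite ?expr0 // exprS mulrS FD IHk.
    by rewrite FX -mulrnAl el0 mul0r.
  rewrite (eq_bigr (fun y => F (e * y))).
    apply: (sum_unity_roots_neq0 (F := fun y => F (e * y)) l_pr Fel).
    exact: reduced_orbit_idem_card.
  by move=> _ /unit_orbitP[u _ ->]; rewrite mulrA ee.
have lc_d : (c < d)%N by rewrite -dE -{1}[c]muln1 ltn_pmul2l ?prime_gt1.
(* If [l] divides [c], then [d] divides [c * c], so [e *+ c] squares to zero and [c] already kills
   [e]. *)
have [/dvdnP[c' cE] | l_ndvd] := boolP (l %| c)%N.
  apply: (IHd c) => //; apply: redR.
  by rewrite expr2 mulrnAl mulrnAr ee -mulrnA {2}cE mulnCA dE mulnC mulrnA ed0 mul0rn.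
have : coprime l c by rewrite prime_coprime.
case/(coprimeP _ (prime_gt0 l_pr)) => [[u v] /= uv].
have ulE : (u * l = v * c + 1)%N.
  by rewrite addnC -uv subnK //; apply: ltnW; rewrite -subn_gt0 uv.
(* These are the idempotents of the Chinese remainder theorem: by [u * l = v * c + 1], [c] kills [f]
   and [l] kills [g]. *)
pose f := e *+ (u * l); pose g := e - f.
have gE : g = - (e *+ (v * c)).
  by rewrite /g /f ulE mulrnDr mulr1n opprD addrC addrNK.
have fg : f * g = 0.
  rewrite gE mulrN /f mulrnAl mulrnAr ee -mulrnA mulnACA dE.
  by rewrite mulnC mulrnA ed0 mul0rn oppr0.
have fe : f * e = f by rewrite /f mulrnAl ee.
have ff : f * f = f by apply/eqP; rewrite eq_sym -subr_eq0 -{1}fe -mulrBr fg.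
have gg : g * g = g by rewrite {1}/g mulrBl fg subr0 /g mulrBr ee mulrC fe.
have fc0 : f *+ c = 0.
  by rewrite /f -mulrnA -mulnA [(l * _)%N]mulnC dE mulnC mulrnA ed0 mul0rn.
have gl0 : g *+ l = 0.
  by rewrite gE mulNrn -mulrnA -mulnA dE mulnC mulrnA ed0 mul0rn oppr0.
have -> : e = f + g by rewrite addrC subrK.
have lt_ld : (l < d)%N.
  by rewrite -dE -{1}[l]mul1n ltn_pmul2r ?prime_gt0 // ltn_neqAle eq_sym c_neq1.
by rewrite sum_orbitD // mulf_neq0 ?(IHd c _ f) ?(IHd l _ g) // prime_gt0.
Qed.

End ReducedSpectrum.

(** * Homogeneous sets and primality *)

Lemma connected_separated (T : finType) (e : rel T) (X : {set T}) a b :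
  symmetric e -> connected e -> (forall x y, x \notin X -> y \in X -> ~~ e x y) ->
  a \notin X -> b \in X -> False.
Proof.
move=> e_sym e_conn sepX aX bX.
have clX : closed e (mem X).
  move=> x y exy; case: (boolP (x \in X)) (boolP (y \in X)) => [xX|xX] [yX|yX] //.
    by have := sepX y x yX xX; rewrite e_sym exy.
  by have := sepX x y xX yX; rewrite exy.
by have := closed_connect clX (e_conn a b); rewrite bX (negPf aX).
Qed.

Section HomogeneousSets.

Variables (T : finType) (e : rel T).
Implicit Types X Y : {set T}.

(** Boolean form, so that [arg_maxnP] can select a homogeneous set of maximal size. *)
Definition homogeneousb X : bool :=
  [forall v, (v \notin X) ==>
    [forall x in X, e v x] || [forall x in X, ~~ e v x]].

Lemma homogeneousP X : reflect (homogeneous e X) (homogeneousb X).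
Proof.
apply: (iffP forallP) => homX v.
  move=> vX; have := implyP (homX v) vX.
  by case/orP => /forall_inP; [left | right].
by apply/implyP => /homX[] allX; apply/orP; [left | right]; apply/forall_inP.
Qed.

Lemma homogeneousU X Y x :
  homogeneous e X -> homogeneous e Y -> x \in X -> x \in Y ->
  homogeneous e (X :|: Y).
Proof.
move=> homX homY xX xY v; rewrite inE negb_or => /andP[/homX hX /homY hY].
case: hX hY => [aX|aX] [aY|aY].
- by left=> y /setUP[/aX|/aY].
- by have := aY x xY; rewrite aX.
- by have := aX x xX; rewrite aY.
- by right=> y /setUP[/aX|/aY].
Qed.

Lemma homogeneous_imset (g : T -> T) X :
  injective g -> (forall x y, e (g x) (g y) = e x y) ->
  homogeneous e X -> homogeneous e (g @: X).
Proof.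
move=> inj_g eg homX v; rewrite -(f_invF inj_g v) => vX.
have /homX[aX | aX] : invF inj_g v \notin X by apply: contra vX; apply: imset_f.
  by left=> _ /imsetP[x xX ->]; rewrite eg aX.
by right=> _ /imsetP[x xX ->]; rewrite eg aX.
Qed.

(** If both sets were proper, the pairs between [X] and its complement would be all adjacent or all
    non-adjacent, so the complement graph or the graph itself would be disconnected. *)
Lemma homogeneous_cover X Y x :
    symmetric e -> connected e -> anti_connected e ->
    homogeneous e X -> homogeneous e Y -> x \in X -> x \in Y ->
    X :|: Y = [set: T] ->
  X = [set: T] \/ Y = [set: T].
Proof.
move=> e_sym e_conn e_anti homX homY xX xY XY.
have hom_eq Z v y z : homogeneous e Z -> v \notin Z -> y \in Z -> z \in Z ->
    e v y = e v z.
  move=> homZ /homZ[] aZ yZ zZ; first by rewrite !aZ.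
  by rewrite (negPf (aZ y yZ)) (negPf (aZ z zZ)).
have [-> | ] := eqVneq X [set: T]; first by left.
rewrite -subTset => /subsetPn[a _ aX].
have [-> | ] := eqVneq Y [set: T]; first by right.
rewrite -subTset => /subsetPn[b _ bY].
have notX v : v \notin X -> v \in Y.
  by have := in_setT v; rewrite -XY inE; case: (v \in X).
have bX : b \in X.
  by have := in_setT b; rewrite -XY inE (negPf bY) orbF.
(* Homogeneity of [X] replaces [w] by [b], which is outside [Y]; homogeneity of [Y] then replaces
   [v] by [a]. *)
have eE v w : v \notin X -> w \in X -> e v w = e a b.
  move=> vX wX; rewrite (hom_eq X v w b) // [e v b]e_sym [e a b]e_sym.
  by apply: (hom_eq Y b v a) => //; apply: notX.
case eab: (e a b).
  have c_sym : symmetric (compl_graph e).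
    by move=> v w; rewrite /compl_graph eq_sym e_sym.
  case: (connected_separated c_sym e_anti _ aX bX) => v w vX wX.
  by rewrite /compl_graph eE // eab andbF.
case: (connected_separated e_sym e_conn _ aX bX) => v w vX wX.
by rewrite eE // eab.
Qed.

(** Take [M] of maximal size. If an automorphism [g] sends a point of [M] into [M], then [g @: M]
    and [M] overlap, so their union is homogeneous; it is proper by [homogeneous_cover], hence equal
    to [M]. *)
Lemma maximal_homogeneous_block X x :
    symmetric e -> connected e -> anti_connected e ->
    homogeneous e X -> x \in X -> (1 < #|X| < #|T|)%N ->
  exists M : {set T}, [/\ x \in M, homogeneous e M, (1 < #|M| < #|T|)%N
    & forall g : T -> T, injective g -> (forall y z, e (g y) (g z) = e y z) ->
      (exists2 y, y \in M & g y \in M) -> {in M, forall y, g y \in M}].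
Proof.
move=> e_sym e_conn e_anti homX xX X_card.
pose P (A : {set T}) := [&& x \in A, homogeneousb A & (1 < #|A| < #|T|)%N].
have PX : P X by rewrite /P xX X_card andbT; apply/homogeneousP.
case: (@arg_maxnP _ X P (fun A => #|A|) PX) => M.
move=> /and3P[xM /homogeneousP homM M_card] maxM.
have /andP[M_gt1 M_lt] := M_card.
exists M; split=> // g inj_g eg [y yM gyM] v vM.
have homgM := homogeneous_imset inj_g eg homM.
have gygM : g y \in g @: M by apply: imset_f.
have [gMT | gMT] := eqVneq (g @: M :|: M) [set: T].
  have card_eq (A : {set T}) : A = [set: T] -> #|A| = #|T|.
    by move=> ->; rewrite cardsT.
  have [] := homogeneous_cover e_sym e_conn e_anti homgM homM gygM gyM gMT.
    by move/card_eq/eqP; rewrite card_imset // ltn_eqF.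
  by move/card_eq/eqP; rewrite ltn_eqF.
have /maxM : P (g @: M :|: M).
  rewrite /P inE xM orbT /=; apply/and3P; split.
  - by apply/homogeneousP; apply: homogeneousU gygM gyM.
  - by apply: leq_trans M_gt1 _; rewrite subset_leq_card ?subsetUr.
  by rewrite -cardsT proper_card // properEneq gMT subsetT.
move=> cardU; have /eqP MU : M == g @: M :|: M by rewrite eqEcard subsetUr.
by rewrite MU inE imset_f.
Qed.

End HomogeneousSets.

(** * Cayley graphs of groups of units *)

Section UnitCayley.

Variables (R : finComUnitRingType) (U : {group {unit R}}).

Let S : {set R} := [set FinRing.uval u | u in U].

Lemma one_mem_units : 1 \in S.
Proof. by apply/imsetP; exists 1%g; rewrite ?group1. Qed.

Lemma mem_units_mul a u : u \in U -> (a * FinRing.uval u \in S) = (a \in S).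
Proof.
move=> uU; apply/imsetP/imsetP => -[v vU av].
  by exists (v * u^-1)%g; rewrite ?groupM ?groupV //= -av mulrK ?(valP u).
by exists (v * u)%g; rewrite ?groupM //= av.
Qed.

Lemma cayley_sym (A : {set R}) : symmetric_subset A -> symmetric (cayley A).
Proof.
case=> AN _ a b; have AN' x : x \in A -> - x \in A.
  by move=> xA; rewrite -AN; apply: imset_f.
by rewrite /cayley -[b - a]opprB; apply/idP/idP => /AN'; rewrite ?opprK.
Qed.

(** Translations and multiplications by [U] are automorphisms, so the block [M] through 0 is a
    subgroup stable under [U]. It is then shown to be an ideal of nilpotent elements. *)
Lemma reduced_prime_graph :
    reduced R -> symmetric_subset S -> connected (cayley S) ->
  anti_connected (cayley S) -> prime_graph (cayley S).
Proof.
move=> redR symS conn anti [X0 homX0 X0_card].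
have e_sym := cayley_sym symS.
have [x0 x0X] : exists x, x \in X0.
  by apply/card_gt0P; case/andP: X0_card => /ltnW.
have subI (t : R) : injective (fun y => y + t) := addIr t.
have cayleyD A (t a b : R) : cayley A (a + t) (b + t) = cayley A a b.
  by rewrite /cayley opprD addrACA subrr addr0.
have [M [M0 homM M_card autM]] : exists M : {set R}, [/\ 0 \in M,
    homogeneous (cayley S) M, (1 < #|M| < #|R|)%N
    & forall g : R -> R, injective g ->
      (forall y z, cayley S (g y) (g z) = cayley S y z) ->
      (exists2 y, y \in M & g y \in M) -> {in M, forall y, g y \in M}].
  apply: (@maximal_homogeneous_block _ _ [set y - x0 | y in X0] 0) => //.
  - by apply: homogeneous_imset homX0; [exact: subI | move=> y z; exact: cayleyD].
  - by apply/imsetP; exists x0; rewrite ?subrr.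
  by rewrite card_imset //; exact: subI.
have MD m m' : m \in M -> m' \in M -> m + m' \in M.
  move=> mM m'M; apply: (autM (fun y => y + m')) => //.
  by exists 0; rewrite ?add0r.
have MN m : m \in M -> - m \in M.
  move=> mM; rewrite -[- m]add0r; apply: (autM (fun y => y - m)) => //.
  by exists m; rewrite ?subrr.
have MS s m : s \in S -> m \in M -> s * m \in M.
  case/imsetP=> u uU -> mM; rewrite mulrC.
  apply: (autM (fun y => y * FinRing.uval u)) => // [|y z|].
  - exact: mulIr (valP u).
  - by rewrite /cayley -mulrBl mem_units_mul.
  by exists 0; rewrite ?mul0r.
(* The multipliers of [M] include 0 and are closed under adjacency, since adjacent elements differ
   by an element of [S]. By connectedness they are all of [R]. *)
pose B := [set b : R | [forall m in M, b * m \in M]].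
have BP b : reflect (forall m, m \in M -> b * m \in M) (b \in B).
  by rewrite inE; apply: forall_inP.
have clB : closed (cayley S) (mem B).
  move=> a b; rewrite /cayley => abS.
  apply/BP/BP => MB m mM.
    by rewrite -[b](subKr a) mulrBl MD ?MB ?MN ?MS.
  by rewrite -[a](subrK b) mulrDl MD ?MB ?MS.
have idealM r m : m \in M -> r * m \in M.
  have /BP : r \in B.
    have := closed_connect clB (conn 0 r) => /= <-.
    by apply/BP => m' _; rewrite mul0r.
  by apply.
have M1 : 1 \notin M.
  apply: contraL M_card => M1; rewrite negb_and -!leqNgt; apply/orP; right.
  rewrite -cardsT subset_leq_card //; apply/subsetP => r _.
  by rewrite -[r]mulr1 idealM.
have unitM m : m \in M -> 1 - m \is a GRing.unit.
  (* 1 is outside [M] and adjacent to 0, hence to every element of [M]. *)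
  move=> mM; have edge0 : cayley S 1 0 by rewrite /cayley subr0 one_mem_units.
  suff /imsetP[u _ ->] : 1 - m \in S by apply: valP.
  by case: (homM 1 M1) => [/(_ m mM) // | /(_ 0 M0)]; rewrite edge0.
case/andP: M_card => /card_gt1P[m1 [m2 [m1M m2M m12]]] _.
have [m m0 mM] : exists2 m, m != 0 & m \in M.
  by have [m1_0 | m1_0] := eqVneq m1 0; [exists m2; rewrite // -m1_0 eq_sym | exists m1].
(* By finiteness two powers of [m] agree: [m ^+ i * (1 - m ^+ (j - i)) = 0], where the second factor
   is a unit. *)
have /injectivePn[i [j ij mij]] : ~~ injectiveb (fun i : 'I_#|R|.+1 => m ^+ i).
  by apply/negP => /injectiveP/leq_card; rewrite card_ord ltnn.
wlog lt_ij : i j ij mij / (i < j)%N => [wlog_ij | ].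
  case: (ltngtP i j) => [|ji|/val_inj/eqP]; first exact: wlog_ij.
    by apply: (wlog_ij j i); rewrite // eq_sym.
  by rewrite (negPf ij).
have /unitM m_unit : m ^+ (j - i) \in M.
  by rewrite -(subnSK lt_ij) exprSr idealM.
case/eqP: m0; apply: (reduced_expr_eq0 (k := i) redR).
apply: (mulIr m_unit); rewrite mul0r mulrBr mulr1 -exprD subnKC ?(ltnW lt_ij) //.
by apply/eqP; rewrite subr_eq0 mij.
Qed.

(** Factoring [u + x * z] as [(1 + x * (z * u^-1)) * u] shows that [S] is a union of cosets of
    [xR]. *)
Lemma mem_units_addM (x : R) :
    (forall y, 1 + x * y \in S) ->
  forall a y, (a + x * y \in S) = (a \in S).
Proof.
move=> S1 a y.
have SD b z : b \in S -> b + x * z \in S.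
  case/imsetP=> u uU ->.
  have -> : FinRing.uval u + x * z =
      (1 + x * (z * FinRing.uval u^-1%g)) * FinRing.uval u.
    by rewrite mulrDl mul1r -!mulrA mulVr ?(valP u) // mulr1.
  by rewrite mem_units_mul.
apply/idP/idP; last exact: SD.
by move/(SD _ (- y)); rewrite mulrN addrK.
Qed.

Lemma nonreduced_not_prime (x : R) :
    x != 0 -> x ^+ 2 = 0 -> (forall y, 1 + x * y \in S) ->
  ~ prime_graph (cayley S).
Proof.
move=> x0 xx S1; apply; exists [set x * y | y : R].
  move=> v _; case: (boolP (v \in S)) => vS; [left | right] => _ /imsetP[y _ ->];
    by rewrite /cayley -mulrN mem_units_addM.
apply/andP; split.
  apply/card_gt1P; exists 0, x; split; last by rewrite eq_sym.
    by apply/imsetP; exists 0; rewrite ?mulr0.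
  by apply/imsetP; exists 1; rewrite ?mulr1.
rewrite -cardsT proper_card // properT; apply/eqP => /setP/(_ 1).
rewrite inE => /imsetP[y _ xy1]; have := oner_neq0 R.
by rewrite -[1](expr1n _ 2) xy1 exprMn xx mul0r eqxx.
Qed.

End UnitCayley.

(** * Groups of [p]-th powers of units and the primality criterion *)

Section PowerGraph.

Variables (R : finComUnitRingType) (n p : nat).
Hypotheses (n_gt1 : (1 < n)%N) (nR0 : forall a : R, a *+ n = 0).
Hypothesis pn : coprime p n.

(** Since [x] squares to zero, the [p]-th power of [1 + x *+ a] is [1 + x *+ (a * p)]; take [a]
    inverse to [p] modulo [n]. *)
Lemma unit_powers_add_sq0 (x : R) :
  x ^+ 2 = 0 -> 1 + x \in [set FinRing.uval u | u in unit_powers R p].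
Proof.
move=> xx; have p_gt0 : (0 < p)%N.
  rewrite lt0n; apply: contraL pn => /eqP ->.
  by rewrite /coprime gcd0n neq_ltn n_gt1 orbT.
have /(coprimeP _ p_gt0)[[a b] /= ab] := pn.
have expD y k : y ^+ 2 = 0 -> (1 + y) ^+ k = 1 + y *+ k.
  move=> yy; elim: k => [|k IHk]; first by rewrite expr0 addr0.
  rewrite exprS IHk mulrDl mul1r mulrDr mulr1 mulrnAr -expr2 yy mul0rn addr0.
  by rewrite mulrSr addrA.
have y2 : (x *+ a) ^+ 2 = 0 by rewrite exprMn_n xx mul0rn.
have y_unit : 1 + x *+ a \is a GRing.unit.
  apply/unitrPr; exists (1 - x *+ a).
  by rewrite mulrC -subr_sqr expr1n y2 subr0.
apply/imsetP; exists (FinRing.unit R y_unit ^+ p)%g; first exact: imset_f.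
rewrite FinRing.val_unitX /= expD // -mulrnA; congr (_ + _).
have -> : (a * p = 1 + b * n)%N.
  by rewrite -ab subnK //; apply: ltnW; rewrite -subn_gt0 ab.
by rewrite mulrnDr mulr1n mulrnA nR0 addr0.
Qed.

(** The [p]-th roots are glued along [f]; gluing their inverses in the same way inverts the result,
    whose [p]-th power is [w]. *)
Lemma unit_powers_split (f : R) : f * f = f ->
  {in unit_powers R p &, forall u v, exists2 w, w \in unit_powers R p &
    f * FinRing.uval w = f * FinRing.uval u /\
    (1 - f) * FinRing.uval w = (1 - f) * FinRing.uval v}.
Proof.
move=> ff _ _ /imsetP[u _ ->] /imsetP[v _ ->].
have f1f : f * (1 - f) = 0 by rewrite mulrBr mulr1 ff subrr.
have gg : (1 - f) * (1 - f) = 1 - f by rewrite mulrBl mul1r f1f subr0.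
pose mix (a b : R) := f * a + (1 - f) * b.
have fmix a b : f * mix a b = f * a by rewrite mulrDr !mulrA ff f1f mul0r addr0.
have gmix a b : (1 - f) * mix a b = (1 - f) * b.
  by rewrite mulrDr !mulrA gg [(1 - f) * f]mulrC f1f mul0r add0r.
have w_unit : mix (FinRing.uval u) (FinRing.uval v) \is a GRing.unit.
  apply/unitrPr; exists (mix (FinRing.uval u^-1%g) (FinRing.uval v^-1%g)).
  rewrite {1}/mix mulrDl -!mulrA ![FinRing.uval _ * mix _ _]mulrC !mulrA.
  by rewrite fmix gmix -!mulrA !mulVr ?(valP u) ?(valP v) // !mulr1 addrC subrK.
have expE (g a b : R) k : g * a = g * b -> g * a ^+ k = g * b ^+ k.
  by move=> gab; elim: k => // k IHk; rewrite !exprS !mulrA gab mulrAC IHk mulrAC.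
exists (FinRing.unit R w_unit ^+ p)%g; first exact: imset_f.
by rewrite !FinRing.val_unitX; split; apply: expE; rewrite /= ?fmix ?gmix.
Qed.

End PowerGraph.

Section PrimeIffSpectrum.

Variables (R : finComUnitRingType) (C : numClosedFieldType) (n p : nat).
Variables (chi : {ffun R -> C}) (U : {group {unit R}}).
Hypotheses (n_gt1 : (1 < n)%N) (nR0 : forall a : R, a *+ n = 0).
Hypothesis pn : coprime p n.
Hypothesis chiF : faithful_char chi.
Hypothesis U_p : U = unit_powers R p :> {set {unit R}}.

Let S : {set R} := [set FinRing.uval u | u in U].

Lemma reduced_eigenvalue_neq0 :
  reduced R -> ~~ eigenvalue (adjmx C (cayley S)) 0.
Proof.
move=> redR; apply/negP => /(eigenvalue_cayleyP chiF)[x /esym/eqP].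
have [chi0 chiD _] := chiF.
have U_split f := @unit_powers_split R p f; rewrite -U_p in U_split.
(* [S] is the orbit of the idempotent 1, which [n] kills. *)
apply/negP; have -> : S = orbit 'U%act U 1%R.
  by apply: eq_imset => u; rewrite -[LHS]mul1r.
apply: (sum_orbit_idem_neq0 redR U_split (F := fun y => chi (x * y)) (d := n)).
- by move=> a b; rewrite mulrDr chiD.
- by rewrite mulr0.
- exact: mulr1.
- exact: ltnW.
exact: nR0.
Qed.

(** [S] is stable under translation by all [x * y], and [chi] is not 1 at one of them, so the
    eigenvalue of index 1 vanishes. *)
Lemma nonreduced_eigenvalue0 (x : R) :
  x != 0 -> (forall y, 1 + x * y \in S) -> eigenvalue (adjmx C (cayley S)) 0.
Proof.
move=> x0 S1; have [_ chiD faith] := chiF.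
apply/(eigenvalue_cayleyP chiF); exists 1.
have [y xy1] : exists y, chi (x * y) != 1.
  apply/existsP; rewrite -negb_forall; apply: contra x0 => /forallP x1.
  by apply/eqP/faith => a; apply/eqP.
under eq_bigr => s _ do rewrite mul1r.
rewrite (sum_char_eq0 (f := fun a => chi a) (b := x * y)) // => a.
exact: mem_units_addM.
Qed.

Lemma prime_cayley_powersP :
    symmetric_subset S -> connected (cayley S) -> anti_connected (cayley S) ->
  prime_graph (cayley S) <-> ~~ eigenvalue (adjmx C (cayley S)) 0.
Proof.
move=> symS conn anti.
have [redR | ] := boolP [forall x : R, (x ^+ 2 == 0) ==> (x == 0)].
  have {}redR : reduced R.
    by move=> x /eqP xx; apply/eqP; apply: (implyP (forallP redR x)).
  by split=> _; [exact: reduced_eigenvalue_neq0 | exact: reduced_prime_graph].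
rewrite negb_forall => /existsP[x]; rewrite negb_imply => /andP[/eqP xx x0].
have S1 y : 1 + x * y \in S.
  rewrite /S U_p; apply: (unit_powers_add_sq0 n_gt1 nR0 pn).
  by rewrite exprMn xx mul0r.
split; first by move/(nonreduced_not_prime x0 xx S1).
by rewrite (nonreduced_eigenvalue0 x0 S1).
Qed.

End PrimeIffSpectrum.

Theorem theorem1p2 (C : numClosedFieldType) (R : finComUnitRingType) (n : nat)
    (zeta : C) (chi : {ffun R -> C}) (U : {group {unit R}})
    (m : nat) (K : 'I_m -> {set R}) (r : 'I_m -> R) :
  (0 < n)%N ->
  frobenius n R ->
  n.-primitive_root zeta ->
  generating_character n zeta chi ->
  (exists2 u, u \in U & FinRing.uval u = -1) ->
  injective K ->
  [set K i | i : 'I_m] = [set orbit 'U%act U x | x : R] ->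
  (forall i, r i \in K i) ->
  [/\ supercharacter_theory K (fun i => [fset mulchar chi x | x in K i]%fset) /\
      symmetric_family K,
      forall S : {set R}, symmetric_subset S -> unitary U S ->
        forall a : C, eigenvalue (adjmx C (cayley S)) a ->
          exists i : 'I_m, a = eigen_sum chi U S K r i,
      forall (T : {set R}) (L : splittingFieldType rat) (z : L)
          (iota : {rmorphism L -> C}) (F : {subfield L})
          (H1 : {group {unit 'Z_n}}),
        symmetric_subset T ->
        n.-primitive_root z -> <<1; z>>%VS = {:L}%VS -> iota z = zeta ->
        fixedField (cyclotomic_gal z H1) = F ->
        (rational_graph iota F (cayley T) <->
         unitary (Zn_unit_image R H1) T)
    & forall p : nat, p = 1%N \/ prime p /\ coprime p n ->
        U = unit_powers R p :> {set {unit R}} ->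
        let Gamma := cayley [set FinRing.uval u | u in unit_powers R p] in
        connected Gamma -> anti_connected Gamma ->
        (prime_graph Gamma <-> ~~ eigenvalue (adjmx C Gamma) 0)].
Proof.
move=> n_gt0 [nR0 _] prim chi_gen [u1 u1U u1E] K_inj K_orbits rK.
have n_gt1 := char_ring_gt1 n_gt0 nR0.
have chiF := generating_character_faithful n_gt1 prim chi_gen.
split.
- split; first exact: (orbit_supercharacter K_inj K_orbits rK chiF).
  exact: (orbit_family_opp K_orbits u1U u1E).
- by move=> S _ US a; apply: (cayley_eigen_sum K_inj K_orbits rK chiF).
- move=> T L z iota F H1 _ prim_z _ iota_z fixF.
  exact: (rational_unitary T n_gt1 nR0 prim prim_z chi_gen iota_z fixF).
move=> p p_cond U_p Gamma conn anti.
have pn : coprime p n by case: p_cond => [-> | []]; rewrite ?coprime1n.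
rewrite /Gamma -U_p in conn anti *.
apply: (prime_cayley_powersP n_gt1 nR0 pn chiF U_p) => //; split.
  apply/setP => a; apply/imsetP/idP => [[s sS ->] | aS].
    by rewrite -mulrN1 -u1E mem_units_mul.
  by exists (- a); rewrite ?opprK // -mulrN1 -u1E mem_units_mul.
by apply/imsetP => -[u _ u0]; have := valP u; rewrite /= -u0 unitr0.
Qed.
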